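(* There exists an absolute constant $c>0$ such that for every finite set $A\subset\mathbb{R}$ with $|A|\ge2$, $$\left|\frac{A+A}{A+A}+\frac{A}{A}\right| \ \ge\ c\,\frac{|A|^{2+\frac{2}{17}}}{\log^{16/17}|A|}.$$
   Context: Here $\frac{A+A}{A+A}+\frac{A}{A}=\left\{\frac{a_1+a_2}{a_3+a_4}+\frac{a_5}{a_6}: a_1,\dots,a_6\in A,\ a_3+a_4\ne0,\ a_6\neq0\right\}$. Logarithms are base $2$, and $\log^{s}x=(\log x)^{s}$. *)

(* Defs.v *)
From HB Require Import structures.
From mathcomp Require Import all_boot all_order all_algebra.
From mathcomp Require Import finmap.
From mathcomp Require Import all_classical all_reals all_analysis.

Set Implicit Arguments.
Unset Strict Implicit.
Unset Printing Implicit Defensive.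

Import Order.TTheory GRing.Theory Num.Theory.
Local Open Scope classical_set_scope.
Local Open Scope ring_scope.

Definition log2 (R : realType) (x : R) : R := ln x / ln 2.

(* (A + A) / (A + A) + A / A *)
Definition ratio_sumset (R : realType) (A : {fset R}) : set R :=
  [set x | exists a1 a2 a3 a4 a5 a6 : R,
     [/\ [/\ a1 \in A, a2 \in A & a3 \in A],
         [/\ a4 \in A, a5 \in A & a6 \in A],
         a3 + a4 != 0,
         a6 != 0 &
         x = (a1 + a2) / (a3 + a4) + a5 / a6]].

(* [fset_set] is a junk value on infinite sets; this shows that
   [#|` fset_set (ratio_sumset A)|] is the genuine cardinality. *)
Lemma finite_ratio_sumset (R : realType) (A : {fset R}) :
  finite_set (ratio_sumset A).
Proof.
have finA : finite_set [set` A] by exact: finite_fset.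
have finAA : finite_set [set a + b | a in [set` A] & b in [set` A]].
  exact: finite_image2.
pose quot (X Y : set R) := [set x / y | x in X & y in Y].
apply: (@sub_finite_set _ _ [set u + v |
    u in quot [set a + b | a in [set` A] & b in [set` A]]
              [set a + b | a in [set` A] & b in [set` A]]
  & v in quot [set` A] [set` A]]); last first.
  by apply: finite_image2; apply: finite_image2.
move=> x [a1 [a2 [a3 [a4 [a5 [a6 [[A1 A2 A3] [A4 A5 A6] _ _ ->]]]]]]].
exists ((a1 + a2) / (a3 + a4)).
  exists (a1 + a2); first by exists a1 => //; exists a2.
  by exists (a3 + a4) => //; exists a3 => //; exists a4.
by exists (a5 / a6) => //; exists a5 => //; exists a6.
Qed.

(* Main.v *)
Require Import Defs.
From HB Require Import structures.
From mathcomp Require Import all_boot all_order all_algebra.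
From mathcomp Require Import finmap.
From mathcomp Require Import all_classical all_reals all_analysis.
From mathcomp Require Import zify ring lra.

(** Let [B] be a set of [n] positive reals, [Q = B / B] the set of slopes of the
    lines through the origin that meet the grid [B * B], [K = |Q|],
    [S = (B + B) / (B + B)] and [T = |S + Q|].  Passing to the positive or to
    the negative elements of [A] reduces the theorem to a lower bound for [T].
    Two bounds, effective in opposite ranges of [K], are combined.

    Many slopes.  [S] is closed under inversion, so for [q] and [q'] in [Q] the
    hyperbola [(t - q) * (t' - q') = 1] has [|S|] points in the grid
    [(S + Q) * (S + Q)].  An incidence bound then gives that [T ^ 4] is at least
    a multiple of [K ^ 2 * |S| ^ 3] ([card_translates_lower]).

    Few slopes.  The elements of [S] are the slopes of the sums of two vectors
    of [B * B].  The slope of a sum lies between the slopes of its terms, so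
    sums of vectors of consecutive lines already give [|S| >= n ^ 2 - n]
    ([card_sum_ratios]).  If the lines carry many points, one gains by taking
    [2 * M] consecutive lines and adding every vector of the [M] lower lines to
    every vector of the [M] upper ones: if each line has [M ^ 6] points, the
    number of coincidences is small enough for a positive proportion of the
    [M ^ 2] pairs of lines, times [M ^ 6], to give distinct slopes
    ([cluster_mediants], [card_rich]).  Summing over a dyadic decomposition of
    the lines by their number of points yields, for every [m],
    [n ^ 2 * m <= K * m ^ 7 + 1792 * |S|] ([sq_card_layers]).

    With [m] the integer part of the eighth root of [n], either
    [K < n ^ 2 / (2 * m ^ 6)] and the second bound gives
    [n ^ 2 * m <= 3584 * |S|], or [K] is large and the first bound does as well
    ([expander_bound]).  So [T] is at least a multiple of [n ^ (2 + 1 / 8)],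
    and [1 / 8] exceeds [2 / 17], while [log2 |A| >= 1].

    Both bounds rest on one incidence estimate ([incidence_grid]): in a grid cut
    into [D * D] cells a monotone curve meets fewer than [2 * D] cells, and
    inside a cell two points lie on few curves.  For monotone curves this
    replaces the Szemeredi-Trotter theorem and has a short proof. *)

Set Implicit Arguments.
Unset Strict Implicit.
Unset Printing Implicit Defensive.

Import Order.TTheory GRing.Theory Num.Theory.
Local Open Scope fset_scope.
Local Open Scope ring_scope.

(** * Counting *)

Lemma leq_card_fset_inj (K L : choiceType) (f : K -> L) (A : {fset K})
    (B : {fset L}) :
  {in A &, injective f} -> {in A, forall x, f x \in B} ->
  (#|` A| <= #|` B|)%N.
Proof.
move=> f_inj fB; have <- : #|` [fset f x | x in A]| = #|` A|.
  by rewrite card_in_imfset.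
by apply/fsubset_leq_card/fsubsetP => _ /imfsetP[x /= xA ->]; exact: fB.
Qed.

Lemma leq_card_finset_fset_inj (T : finType) (K : choiceType) (f : T -> K)
    (A : {set T}) (X : {fset K}) :
  {in A &, injective f} -> {in A, forall x, f x \in X} -> (#|A| <= #|` X|)%N.
Proof.
move=> f_inj fX; have <- : #|` [fset f x | x in A]| = #|A|.
  by rewrite card_in_imfset //= -cardE.
by apply/fsubset_leq_card/fsubsetP => _ /imfsetP[x /= xA ->]; exact: fX.
Qed.

(** Two given points lie on few curves because the parameter of such a curve
    solves a quadratic equation; this is how the multiplicity [s = 2] of
    [incidence_grid] is obtained, both for mediants and for hyperbolas. *)
Lemma card_quadratic_roots (F : idomainType) (C : finType) (S : {set C})
    (g : C -> F) (k0 k1 k2 : F) :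
  (k0 != 0) || (k2 != 0) -> {in S &, injective g} ->
  {in S, forall c, k0 + k1 * g c + k2 * g c ^+ 2 = 0} -> (#|S| <= 2)%N.
Proof.
move=> nz g_inj rt; rewrite -ltnS; apply: leq_trans (size_Poly [:: k0; k1; k2]).
rewrite cardE -(size_map g); apply: max_poly_roots.
- apply: contraTneq nz => /polyP P0.
  by have := P0 0; have := P0 2; rewrite !coef_Poly !coef0 /= => -> ->; rewrite eqxx.
- apply/allP => _ /mapP[c + ->]; rewrite mem_enum => cS.
  rewrite rootE horner_Poly /= mul0r add0r -(rt c cS); apply/eqP; ring.
rewrite map_inj_in_uniq ?enum_uniq // => c c'.
by rewrite !mem_enum; exact: g_inj.
Qed.

(** Cauchy-Schwarz applied to the sizes of the fibres of [f]. *)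
Lemma sq_card_le_collisions (W : finType) (K : choiceType) (f : W -> K)
    (X : {fset K}) :
  (forall w, f w \in X) ->
  (#|W| ^ 2 <= #|` X| * #|[set w : W * W | f w.1 == f w.2]|)%N.
Proof.
move=> fX; pose n (k : X) := #|[set w | f w == val k]|.
have cW : #|W| = (\sum_k n k)%N.
  rewrite -sum1_card (partition_big (fun w => [` fX w]) predT) //=.
  apply: eq_bigr => k _; rewrite /n -sum1dep_card; apply: eq_bigl => w.
  by rewrite -val_eqE.
have cC : #|[set w : W * W | f w.1 == f w.2]| = (\sum_k n k ^ 2)%N.
  rewrite -sum1dep_card (partition_big (fun w => [` fX w.1]) predT) //=.
  apply: eq_bigr => k _; rewrite /n expnS expn1 -cardsX -sum1_card.
  apply: eq_bigl => -[w w']; rewrite !inE -!val_eqE /=.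
  by apply/andP/andP => -[/eqP-> /eqP->]; rewrite !eqxx.
rewrite cC cW cardfE -(leq_pmul2l (isT : (0 < 2)%N)) -mulnn big_distrlr /=.
rewrite big_distrr /=; under eq_bigr => k _ do rewrite big_distrr /=.
apply: (@leq_trans (\sum_(k : X) \sum_(l : X) (n k ^ 2 + n l ^ 2))%N).
  by apply: leq_sum => k _; apply: leq_sum => l _; exact: nat_Cauchy.
suff -> : (\sum_(k : X) \sum_(l : X) (n k ^ 2 + n l ^ 2) =
           2 * (#|{: X}| * \sum_(k : X) n k ^ 2))%N by [].
rewrite mul2n -addnn -{2}sum_nat_const big_distrr -big_split /=.
by apply: eq_bigr => k _; rewrite big_split /= sum_nat_const.
Qed.

(** * Incidences of monotone curves with grids *)

(** Every class contributes one representative, and any further element forms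
    a pair with the representative of its class. *)
Lemma card_le_classes_pairs (P : finType) (F : {set P}) (g : P -> nat) N :
  {in F, forall p, (g p < N)%N} ->
  (#|F| <= N + #|[set w : P * P | [&& w.1 \in F, w.2 \in F, w.1 != w.2
                                    & g w.1 == g w.2]]|)%N.
Proof.
move=> gN.
pose h k := [pick q in F | g q == k].
pose reps := [set p in F | h (g p) == Some p].
rewrite -(cardsID reps F) leq_add //.
  rewrite -[leqRHS]card_ord.
  have gN' (p : P) : p \in F :&: reps -> (g p < N)%N by case/setIP=> /gN.
  case: N gN gN' => [|N] gN gN'.
    by rewrite (_ : F :&: reps = finset.set0) ?cards0 //; apply/setP => p;
      rewrite [RHS]inE; apply/negP => /gN'.
  rewrite -(@card_in_imset _ _ (fun p => inord (g p) : 'I_N.+1)).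
    exact: max_card.
  move=> p q pF qF /(congr1 val); rewrite /= !inordK ?gN' // => e.
  move: pF qF; rewrite !inE => /and3P[_ _ /eqP hp] /and3P[_ _ /eqP].
  by rewrite -e hp => -[].
pose r p := odflt p (h (g p)).
rewrite -(@card_in_imset _ _ (fun p => (p, r p))); last by move=> p q _ _ [].
apply/subset_leq_card/fintype.subsetP => w /imsetP[p].
rewrite !inE => /andP[+ pF] ->; rewrite pF /= /r /h.
case: pickP => [q /andP[qF /eqP ->]|/(_ p)]; last by rewrite pF eqxx.
by rewrite /= qF eqxx andbT /=; apply: contraNneq => ->.
Qed.

Section Blocks.
Variables (R : realFieldType) (U : finType) (u : U -> R) (D e : nat).
Hypotheses (u_inj : injective u) (cardU : (#|U| <= D * e)%N).

Definition nb_below (x : U) := #|[set y | u y < u x]|.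

Lemma nb_below_lt x : (nb_below x < #|U|)%N.
Proof.
rewrite /nb_below -cardsT; apply/proper_card/properP; split; first exact: finset.subsetT.
by exists x; rewrite ?inE ?ltxx.
Qed.

Lemma nb_below_le x y : u x <= u y -> (nb_below x <= nb_below y)%N.
Proof.
move=> xy; apply/subset_leq_card/fintype.subsetP => z.
by rewrite !inE => /lt_le_trans->.
Qed.

Lemma nb_below_inj : injective nb_below.
Proof.
have lt x y : u x < u y -> (nb_below x < nb_below y)%N.
  move=> xy; apply/proper_card/properP; split.
    by apply/fintype.subsetP => z; rewrite !inE => /lt_trans->.
  by exists x; rewrite !inE ?ltxx.
move=> x y xy; apply: u_inj; case: (ltgtP (u x) (u y)) => // /lt;
  by rewrite xy ltnn.
Qed.

(** Cutting the values of [u], listed in increasing order, into runs of length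
    [e]: the column (or row) of the grid cell in which a point lies. *)
Definition block x := (nb_below x %/ e)%N.

Lemma block_lt x : (block x < D)%N.
Proof.
have lt_De := leq_trans (nb_below_lt x) cardU.
have [e0|e0] := posnP e; first by rewrite e0 muln0 in lt_De.
by rewrite ltn_divLR.
Qed.

Lemma block_le x y : u x <= u y -> (block x <= block y)%N.
Proof. by move=> /nb_below_le; exact: leq_div2r. Qed.

Lemma card_block k : (#|[set x | block x == k]| <= e)%N.
Proof.
have [e0|e0] := posnP e.
  rewrite [X in (_ <= X)%N]e0 leqn0 cards_eq0; apply/eqP/setP => x.
  by have := leq_trans (nb_below_lt x) cardU; rewrite e0 muln0.
rewrite -[leqRHS]card_ord.
pose f x : 'I_e := Ordinal (ltn_pmod (nb_below x) e0).
rewrite -(@card_in_imset _ _ f); first exact: max_card.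
move=> x y; rewrite !inE => /eqP bx /eqP byy /(congr1 val) /= exy.
apply: nb_below_inj; rewrite (divn_eq (nb_below x) e) (divn_eq (nb_below y) e).
by rewrite exy; move: bx byy; rewrite /block => -> ->.
Qed.

End Blocks.

(** The Szemeredi-Trotter bound for increasing curves in a grid.  The grid is
    cut into [D ^ 2] cells of side [e].  An increasing curve meets fewer than
    [2 * D] cells, because the column number plus the row number determines the
    cell along the curve; the first point in each of these cells accounts for
    the first term.  Every further incidence gives a pair of points of one curve
    in one cell; there are at most [D ^ 2 * e ^ 4] pairs of points in a common
    cell and each lies on at most [s] curves. *)
Lemma incidence_grid (R : realFieldType) (C U V : finType)
    (u : U -> R) (v : V -> R) (inc : C -> U -> V -> bool) (D e s : nat) :
  injective u -> injective v -> (#|U| <= D * e)%N -> (#|V| <= D * e)%N ->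
  (forall c x y x' y', inc c x y -> inc c x' y' ->
     (u x <= u x') = (v y <= v y')) ->
  (forall x y x' y', x != x' -> y != y' ->
     (#|[set c | inc c x y && inc c x' y']| <= s)%N) ->
  (\sum_c #|[set p : U * V | inc c p.1 p.2]|
     <= D.*2 * #|C| + s * (D ^ 2 * e ^ 4))%N.
Proof.
move=> u_inj v_inj cU cV mono pairs.
pose b := block u e; pose b' := block v e.
pose cell (w : (U * V) * (U * V)) :=
  [&& w.1.1 != w.2.1, w.1.2 != w.2.2, b w.1.1 == b w.2.1
     & b' w.1.2 == b' w.2.2].
have cellP : (#|[set w | cell w]| <= D ^ 2 * e ^ 4)%N.
  apply: (@leq_trans (\sum_(p : U * V) e ^ 2)).
    rewrite -sum1dep_card (eq_bigl (fun w => predT w.1 && cell (w.1, w.2)));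
      last by case.
    rewrite -(pair_big_dep predT (fun p q => cell (p, q)) (fun _ _ => 1%N)) /=.
    apply: leq_sum => -[x y] _; rewrite sum1dep_card.
    apply: (@leq_trans #|finset.setX [set x' | block u e x' == b x]
                          [set y' | block v e y' == b' y]|).
      apply/subset_leq_card/fintype.subsetP => -[x' y']; rewrite !inE /cell /=.
      by case/and4P => _ _ /eqP -> /eqP ->; rewrite !eqxx.
    by rewrite cardsX expnS expn1 leq_mul // (@card_block _ _ _ D).
  rewrite sum_nat_const card_prod (_ : D ^ 2 * e ^ 4 = D * e * (D * e) * e ^ 2)%N;
    last by ring.
  by rewrite leq_mul2r leq_mul ?orbT.
apply: (@leq_trans (\sum_c (D.*2 +
   #|[set w | cell w && (inc c w.1.1 w.1.2 && inc c w.2.1 w.2.2)]|))).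
  apply: leq_sum => c _.
  (* Along an increasing curve both coordinates of the cell are nondecreasing,
     so equal sums force equal cells. *)
  pose g (p : U * V) := (b p.1 + b' p.2)%N.
  have gD : {in [set p | inc c p.1 p.2], forall p, (g p < D.*2)%N}.
    move=> p _; rewrite -addnn /g -addSn leq_add ?block_lt //.
    by apply: ltnW; apply: block_lt.
  apply: leq_trans (card_le_classes_pairs gD) _.
  rewrite leq_add2l; apply/subset_leq_card/fintype.subsetP => -[[x y] [x' y']].
  rewrite !inE /cell /g /= => /and4P[i i' ne /eqP gg]; rewrite i i' !andbT.
  have Ex : (x == x') = (y == y').
    apply/eqP/eqP => [E|E]; [apply: v_inj|apply: u_inj]; apply/eqP;
      rewrite eq_le.
      by rewrite -(mono _ _ _ _ _ i i') -(mono _ _ _ _ _ i' i) E lexx.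
    by rewrite (mono _ _ _ _ _ i i') (mono _ _ _ _ _ i' i) E lexx.
  have nx : x != x' by move: ne; rewrite xpair_eqE -Ex andbb.
  rewrite -Ex nx /=.
  have [le_x|lt_x] := leP (u x) (u x').
    have le_y : v y <= v y' by rewrite -(mono _ _ _ _ _ i i').
    have := block_le e le_x; have := block_le e le_y.
    by rewrite -/b -/b'; move: gg; lia.
  have le_x := ltW lt_x.
  have le_y : v y' <= v y by rewrite -(mono _ _ _ _ _ i' i).
  have := block_le e le_x; have := block_le e le_y.
  by rewrite -/b -/b'; move: gg; lia.
rewrite big_split /= sum_nat_const mulnC leq_add2l.
under eq_bigr => c _ do rewrite -sum1dep_card big_mkcondr /=.
rewrite exchange_big /=.
apply: (@leq_trans (\sum_(w | cell w) s)).
  apply: leq_sum => -[[x y] [x' y']] /and4P[/= nx ny _ _].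
  rewrite -big_mkcond /= sum1dep_card; exact: pairs.
by rewrite sum_nat_cond_const mulnC leq_mul2l -sum1dep_card sum1dep_card cellP orbT.
Qed.

(** * Slopes of vector sums from a cluster of lines *)

Section Mediant.
Variable R : realFieldType.
Implicit Types a b c d x y z w : R.

(** The slope of the sum of the vectors [(x, a * x)] and [(z, c * z)], which lie
    on the lines of slopes [a] and [c] through the origin. *)
Definition mediant a c x z := (a * x + c * z) / (x + z).

Lemma mediant_gt a c x z : a < c -> 0 < x -> 0 < z -> a < mediant a c x z.
Proof.
by move=> ac x0 z0; rewrite /mediant ltr_pdivlMr ?addr_gt0 //; nra.
Qed.

Lemma mediant_lt a c x z : a < c -> 0 < x -> 0 < z -> mediant a c x z < c.
Proof.
by move=> ac x0 z0; rewrite /mediant ltr_pdivrMr ?addr_gt0 //; nra.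
Qed.

Lemma mediant_le a c x y z : a < c -> 0 < x -> 0 < y -> 0 < z ->
  (mediant a c x z <= mediant a c y z) = (y <= x).
Proof.
move=> ac x0 y0 z0.
rewrite /mediant ler_pdivrMr ?addr_gt0 // mulrAC ler_pdivlMr ?addr_gt0 //.
rewrite -subr_ge0 (_ : _ - _ = (c - a) * z * (x - y)); last by ring.
by rewrite pmulr_rge0 ?subr_ge0 // mulr_gt0 // subr_gt0.
Qed.

Lemma mediant_inj a c x y z : a < c -> 0 < x -> 0 < y -> 0 < z ->
  mediant a c x z = mediant a c y z -> x = y.
Proof.
move=> ac x0 y0 z0 E; apply/eqP.
by rewrite eq_le -(mediant_le ac y0 x0 z0) -(mediant_le ac x0 y0 z0) E lexx.
Qed.

Lemma mediant_injr a c x y z : a < c -> 0 < x -> 0 < y -> 0 < z ->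
  mediant a c z x = mediant a c z y -> x = y.
Proof.
move=> ac x0 y0 z0 /eqP; rewrite /mediant.
rewrite eqr_div ?lt0r_neq0 ?addr_gt0 // -subr_eq0.
rewrite (_ : _ - _ = (c - a) * z * (x - y)); last by ring.
by rewrite !mulf_eq0 !subr_eq0 (gt_eqF ac) (gt_eqF z0) /= => /eqP.
Qed.

Lemma mediant_eqE a b c d x y z w : 0 < x -> 0 < y -> 0 < z -> 0 < w ->
  mediant a c x z = mediant b d y w <->
  ((a - b) * x + (c - b) * z) * y = ((d - a) * x + (d - c) * z) * w.
Proof.
move=> x0 y0 z0 w0; rewrite /mediant.
split=> [/eqP|/eqP E].
  rewrite eqr_div ?lt0r_neq0 ?addr_gt0 // => /eqP; lra.
apply/eqP; rewrite eqr_div ?lt0r_neq0 ?addr_gt0 //; move/eqP: E => E.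
by apply/eqP; lra.
Qed.

End Mediant.

(** For fixed second vectors [z] and [w], equality of the two slopes says that
    [(x, y)] lies on an increasing curve, both slopes being decreasing functions
    of the first abscissa.  Two points of that curve give two equations in [z]
    and [w]; eliminating [w] leaves a quadratic equation for [z], whose extreme
    coefficients both vanish only if the two pairs of lines coincide. *)
Lemma pair_collisions (R : realFieldType) (T : finType) (a b c d : R)
    (x y z w : T -> R) (D e : nat) :
  a < c -> b < d -> a < d -> b < c -> (a, c) != (b, d) ->
  injective x -> injective y -> injective z -> injective w ->
  (forall t, [/\ 0 < x t, 0 < y t, 0 < z t & 0 < w t]) ->
  (#|T| <= D * e)%N ->
  (\sum_(p : T * T) #|[set q : T * T | mediant a c (x q.1) (z p.1)
                                     == mediant b d (y q.2) (w p.2)]|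
    <= D.*2 * #|T| ^ 2 + 2 * (D ^ 2 * e ^ 4))%N.
Proof.
move=> ac bd ad bc ne x_inj y_inj z_inj w_inj pos cT.
have := @incidence_grid R (T * T)%type T T x y (fun p t t' =>
  mediant a c (x t) (z p.1) == mediant b d (y t') (w p.2)) D e 2.
rewrite card_prod mulnn; apply => //.
  move=> p t1 t1' t2 t2' /eqP E1 /eqP E2.
  have [[? _ ? _] [? _ _ _]] := (pos t1, pos t2).
  have [[_ ? _ _] [_ ? _ _]] := (pos t1', pos t2').
  have [[_ _ ? _] [_ _ _ ?]] := (pos p.1, pos p.2).
  by rewrite -(@mediant_le _ a c _ _ (z p.1)) // E1 E2 mediant_le.
move=> t1 t1' t2 t2' nt nt'.
have [x1 x2] : 0 < x t1 /\ 0 < x t2 by case: (pos t1); case: (pos t2).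
have [y1 y2] : 0 < y t1' /\ 0 < y t2' by case: (pos t1'); case: (pos t2').
have neY : y t1' - y t2' != 0 by rewrite subr_eq0 (inj_eq y_inj).
set S := [set _ | _].
pose k0 := (a - b) * (d - a) * x t1 * x t2 * (y t1' - y t2').
pose k2 := (c - b) * (d - c) * (y t1' - y t2').
pose k1 := y t1' * ((a - b) * x t1 * (d - c) + (c - b) * (d - a) * x t2)
         - y t2' * ((a - b) * x t2 * (d - c) + (c - b) * (d - a) * x t1).
apply: (@card_quadratic_roots _ _ _ (fun p => z p.1) k0 k1 k2).
- rewrite /k0 /k2 !mulf_eq0 (negPf neY) (gt_eqF x1) (gt_eqF x2) !orbF !subr_eq0.
  rewrite (gt_eqF ad) (gt_eqF bc) orbF /=.
  by move: ne; rewrite xpair_eqE negb_and (eq_sym d).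
- move=> [s s'] [r r']; rewrite !inE /= => /andP[/eqP E _] /andP[/eqP E' _].
  move=> /z_inj sr; rewrite -{}sr in E' *; congr (_, _); apply: w_inj.
  have [[_ _ _ ?] [_ _ _ ?]] := (pos s', pos r').
  by apply: (mediant_injr bd _ _ y1) => //; rewrite -E E'.
move=> [s s']; rewrite !inE /= => /andP[/eqP + /eqP].
have [[_ _ zs _] [_ _ _ ws]] := (pos s, pos s').
move=> /mediant_eqE-/(_ x1 y1 zs ws) E1 /mediant_eqE-/(_ x2 y2 zs ws) E2.
have E : (((a - b) * x t1 + (c - b) * z s) * y t1') *
         (((d - a) * x t2 + (d - c) * z s) * w s') =
         (((a - b) * x t2 + (c - b) * z s) * y t2') *
         (((d - a) * x t1 + (d - c) * z s) * w s').
  by rewrite E1 E2 mulrC.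
apply: (mulIf (lt0r_neq0 ws)); rewrite mul0r /k0 /k1 /k2.
by move/eqP: E; rewrite -subr_eq0 => /eqP <-; ring.
Qed.

(** The [M ^ 2 * M ^ 12] sums of a vector on a lower line and a vector on an
    upper line have almost as few coincidences among their slopes as possible:
    a pair of lines collides with itself at most [M ^ 18] times, and with each
    of the fewer than [M ^ 2] other pairs at most [4 * M ^ 16] times.  So all
    pairs of lines together collide at most [5 * M ^ 20] times.  The size
    [M ^ 6] of the lines is the one for which the two kinds of collisions
    balance. *)
Lemma cluster_mediants (R : realFieldType) (M : nat) (X : {fset R})
    (lam mu : 'I_M -> R) (x z : 'I_M -> 'I_(M ^ 6) -> R) :
  injective lam -> injective mu -> (forall i j, lam i < mu j) ->
  (forall i, injective (x i)) -> (forall i, injective (z i)) ->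
  (forall i t, 0 < x i t /\ 0 < z i t) ->
  (forall i j s t, mediant (lam i) (mu j) (x i s) (z j t) \in X) ->
  (M ^ 8 <= 5 * #|` X|)%N.
Proof.
move=> lam_inj mu_inj lam_mu x_inj z_inj pos inX.
have [->//|M0] := posnP M.
pose f (w : ('I_M * 'I_M) * ('I_(M ^ 6) * 'I_(M ^ 6))) :=
  mediant (lam w.1.1) (mu w.1.2) (x w.1.1 w.2.1) (z w.1.2 w.2.2).
have := @sq_card_le_collisions _ _ f X (fun w => inX _ _ _ _).
rewrite !card_prod !card_ord.
set coll := #|_|; suff cle : (coll <= 5 * M ^ 20)%N.
  move=> h; have {}h := leq_trans h (leq_mul (leqnn _) cle).
  rewrite -(@leq_pmul2r (M ^ 20)) ?expn_gt0 ?M0 // (mulnC 5) -mulnA.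
  by apply: leq_trans h; rewrite eq_leq //; ring.
pose I2 := ('I_M * 'I_M)%type; pose T := 'I_(M ^ 6).
pose N (p p' : I2) := (\sum_(q : T * T) #|[set q' : T * T |
  mediant (lam p.1) (mu p.2) (x p.1 q'.1) (z p.2 q.1) ==
  mediant (lam p'.1) (mu p'.2) (x p'.1 q'.2) (z p'.2 q.2)]|)%N.
have {}/leq_trans-> // : (coll <= \sum_(p : I2) \sum_(p' : I2) N p p')%N.
  rewrite pair_big /= /coll -sum1dep_card.
  rewrite (partition_big (fun w => (w.1.1, w.2.1)) predT) //=.
  apply: leq_sum => -[p p'] _; rewrite /N /= sum1dep_card.
  under eq_bigr => q _ do rewrite -sum1dep_card.
  rewrite pair_big_dep /= sum1dep_card.
  pose h (w : (I2 * (T * T)) * (I2 * (T * T))) :=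
    ((w.1.2.2, w.2.2.2), (w.1.2.1, w.2.2.1)).
  rewrite -(@card_in_imset _ _ h); last first.
    move=> [[p1 [a b]] [p2 [c d]]] [[p1' [a' b']] [p2' [c' d']]].
    rewrite !inE /= => /andP[_ /eqP[-> ->]] /andP[_ /eqP[-> ->]].
    by rewrite /h /= => -[-> -> -> ->].
  apply/subset_leq_card/fintype.subsetP => _ /imsetP[[[p1 [a b]] [p2 [c d]]] + ->].
  by rewrite !inE /f /= => /andP[E /eqP[<- <-]].
have Ndiag p : (N p p <= M ^ 18)%N.
  rewrite (_ : M ^ 18 = #|{: T * T}| * M ^ 6)%N; last first.
    by rewrite card_prod card_ord -!expnD.
  rewrite -sum_nat_const; apply: leq_sum => q _; rewrite -[leqRHS]card_ord.
  rewrite -(@card_in_imset _ _ fst); first exact: max_card.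
  move=> [a b] [a' b']; rewrite !inE /= => /eqP E /eqP E' aa'.
  rewrite -{}aa' in E' *; congr (_, _); apply: (x_inj p.1).
  have [xb _] := pos p.1 b; have [xb' _] := pos p.1 b'.
  have [_ zq] := pos p.2 q.2.
  by apply: (mediant_inj (lam_mu p.1 p.2) xb xb' zq); rewrite -E -E'.
have Noff p p' : p != p' -> (N p p' <= 4 * M ^ 16)%N.
  (* The 8/3 power of the size [M ^ 6] comes from [M ^ 4] by [M ^ 4] cells of
     side [M ^ 2]. *)
  move=> np; apply: (@leq_trans ((M ^ 4).*2 * #|{: T}| ^ 2 +
                        2 * ((M ^ 4) ^ 2 * (M ^ 2) ^ 4))).
    apply: pair_collisions => //.
    - apply: contraNneq np; case: p p' => [i j] [i' j'] [/lam_inj -> /mu_inj ->] //.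
    - by move=> t; split; apply pos.
    by rewrite card_ord -expnD.
  by rewrite card_ord -!expnM -mul2n -mulnA -!expnD -mulnDl.
apply: (@leq_trans (\sum_(p : I2) (M ^ 18 + M ^ 2 * (4 * M ^ 16)))).
  apply: leq_sum => p _; rewrite (bigD1 p) //= leq_add //.
  apply: (@leq_trans (\sum_(p' | p' != p) 4 * M ^ 16)).
    by apply: leq_sum => p' np; apply: Noff; rewrite eq_sym.
  rewrite sum_nat_cond_const leq_mul2r; apply/orP; right.
  by apply: leq_trans (max_card _) _; rewrite card_prod card_ord mulnn.
rewrite sum_nat_const card_prod card_ord mulnn mulnCA -expnD -mulSn mulnCA.
by rewrite -expnD.
Qed.

(** * Translates of a set closed under inversion *)

Lemma hyperbola_quadratic (R : realFieldType) (x y x' y' q q' : R) :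
  (x - q) * (y - q') = 1 -> (x' - q) * (y' - q') = 1 ->
  (y - y') * x * x' - (x' - x) + - (y - y') * (x + x') * q
    + (y - y') * q ^+ 2 = 0.
Proof.
move=> E E'.
have F : ((x - q) * (y - q')) * (x' - q) - ((x' - q) * (y' - q')) * (x - q)
         - ((x' - q) - (x - q)) = 0 by rewrite E E' !mul1r subrr.
by rewrite -[RHS]F; ring.
Qed.

(** An Elekes-type argument.  For [q] and [q'] in [Q] the hyperbola
    [(t - q) * (t' - q') = 1] contains the points [(r + q, r^-1 + q')] with [r]
    in [S], all of which lie in [X * X].  So there are [#|` Q| ^ 2] curves with
    [#|` S|] points each in a grid of side [#|` X|].  Using [#|` S| / 4]
    subdivisions, the term of [incidence_grid] that is linear in the number of
    curves is at most half of the number of incidences. *)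
Lemma card_translates_lower (R : realFieldType) (Q S X : {fset R}) :
  {in S, forall r, 0 < r /\ r^-1 \in S} ->
  {in S & Q, forall r q, r + q \in X} ->
  (#|` Q| ^ 2 * #|` S| ^ 3 <= 2 ^ 12 * #|` X| ^ 4)%N.
Proof.
move=> S_pos SQ.
have [->|/fset0Pn[r0 r0S]] := eqVneq S fset0; first by rewrite cardfs0 muln0.
have [->|/fset0Pn[q0 q0Q]] := eqVneq Q fset0; first by rewrite cardfs0 mul0n.
have leS : (#|` S| <= #|` X|)%N.
  apply: (@leq_card_fset_inj _ _ (fun r => r + q0)) => [r r' _ _ /addIr //|r rS].
  exact: SQ.
have leQ : (#|` Q| <= #|` X|)%N.
  by apply: (@leq_card_fset_inj _ _ (fun q => r0 + q)) => [q q' _ _ /addrI //|q qQ];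
    exact: SQ.
have [S4|S4] := ltnP #|` S| 4.
  have S3 : (#|` S| ^ 3 <= 2 ^ 12)%N.
    by apply: (@leq_trans (4 ^ 3)); rewrite ?leq_exp2r 1?ltnW.
  have X0 : (0 < #|` X|)%N.
    by apply: leq_trans leQ; rewrite cardfs_gt0; apply/fset0Pn; exists q0.
  rewrite mulnC leq_mul //; apply: (@leq_trans (#|` X| ^ 2)).
    by rewrite leq_exp2r.
  by rewrite leq_pexp2l.
pose n := #|` X|; pose D := (#|` S| %/ 4)%N; pose e := (n %/ D).+1.
have D0 : (0 < D)%N by rewrite divn_gt0.
have S8D : (#|` S| <= 8 * D)%N by rewrite /D; lia.
have DS : (4 * D <= #|` S|)%N by rewrite /D; lia.
have nDe : (n <= D * e)%N by rewrite mulnC ltnW // ltn_ceil.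
have De2n : (D * e <= 2 * n)%N.
  rewrite /e mulnS mulnC mul2n -addnn leq_add ?leq_divM //.
  by apply: leq_trans leS; lia.
pose inc (c : Q * Q) (t t' : X) :=
  (val c.1 < val t) && ((val t - val c.1) * (val t' - val c.2) == 1).
have inc_gt c t t' : inc c t t' -> 0 < val t - val c.1 /\ 0 < val t' - val c.2.
  move=> /andP[lt_c /eqP E]; have c0 : 0 < val t - val c.1 by rewrite subr_gt0.
  by split=> //; rewrite -(pmulr_rgt0 _ c0) E.
have incE c t t' : inc c t t' -> (val t - val c.1) * (val t' - val c.2) = 1.
  by case/andP => _ /eqP.
(* The branch of the hyperbola is decreasing; negating the second coordinate
   makes it increasing. *)
have := @incidence_grid R (Q * Q)%type X X val (fun t => - val t) inc D e 2 val_inj.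
have /[swap] /[apply] : injective (fun t : X => - val t).
  by move=> t t' /oppr_inj /val_inj.
rewrite -!cardfE => /(_ nDe nDe).
have /[swap] /[apply] : forall c x y x' y', inc c x y -> inc c x' y' ->
    (val x <= val x') = (- val y <= - val y').
  move=> c x y x' y' i i'; rewrite lerN2.
  have [x0 y0] := inc_gt _ _ _ i; have [x0' y0'] := inc_gt _ _ _ i'.
  have E := incE _ _ _ i; have E' := incE _ _ _ i'.
  rewrite -(lerD2r (- val c.1)) -[in RHS](lerD2r (- val c.2)).
  by rewrite -(ler_pM2r y0) E -E' (ler_pM2l x0').
have /[swap] /[apply] : forall x y x' y' : X, x != x' -> y != y' ->
    (#|[set c | inc c x y && inc c x' y']| <= 2)%N.
  move=> x y x' y' nx ny.
  apply: (@card_quadratic_roots _ _ _ (fun c => val c.1)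
    ((val y - val y') * val x * val x' - (val x' - val x))
    (- (val y - val y') * (val x + val x')) (val y - val y')).
  - by apply/orP; right; rewrite subr_eq0 (inj_eq val_inj).
  - move=> [q1 q2] [q1' q2']; rewrite !inE /= => /andP[i _] /andP[i' _].
    move=> /val_inj E; rewrite -{}E in i' *; congr (_, _); apply: val_inj => /=.
    have [x0 _] := inc_gt _ _ _ i.
    apply/oppr_inj/(addrI (val y))/(mulfI (lt0r_neq0 x0)).
    by rewrite (incE _ _ _ i) (incE _ _ _ i').
  move=> [q1 q2]; rewrite inE => /andP[i i'] /=.
  have /= E := incE _ _ _ i; have /= E' := incE _ _ _ i'.
  exact: hyperbola_quadratic E E'.
move=> le_I; have {le_I} : (#|` Q| ^ 2 * #|` S| <=
    D.*2 * #|` Q| ^ 2 + 2 * (D ^ 2 * e ^ 4))%N.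
  rewrite (_ : #|` Q| ^ 2 = #|{: Q * Q}|)%N; last by rewrite card_prod -cardfE mulnn.
  apply: leq_trans le_I.
  rewrite -sum_nat_const; apply: leq_sum => -[q q'] _; rewrite cardfE.
  pose h (r : S) : X * X :=
    ([` SQ _ _ (valP r) (valP q)], [` SQ _ _ (S_pos _ (valP r)).2 (valP q')]).
  rewrite -cardsT -(@card_imset _ _ h); last first.
    by move=> r r' [/addIr /val_inj ->].
  apply/subset_leq_card/fintype.subsetP => _ /imsetP[r _ ->]; rewrite inE /inc /=.
  have [r0' _] := S_pos _ (valP r).
  by rewrite ltrDr r0' !addrK mulfV ?eqxx ?lt0r_neq0.
move=> le_I.
have {le_I} le_I : (#|` Q| ^ 2 * #|` S| <= 4 * (D ^ 2 * e ^ 4))%N by nia.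
have le_I2 : (#|` Q| ^ 2 * #|` S| ^ 3 <= 256 * (D * e) ^ 4)%N.
  rewrite (_ : #|` Q| ^ 2 * #|` S| ^ 3 =
     #|` Q| ^ 2 * #|` S| * #|` S| ^ 2)%N; last by ring.
  apply: (@leq_trans (4 * (D ^ 2 * e ^ 4) * (8 * D) ^ 2)).
    by rewrite leq_mul // leq_exp2r.
  by rewrite eq_leq //; ring.
apply: (leq_trans le_I2); apply: (@leq_trans (256 * (2 * n) ^ 4)).
  by rewrite leq_mul2l leq_exp2r.
by rewrite eq_leq // /n; ring.
Qed.

(** * Slopes of sums from the lines of a grid *)

Lemma card_interval_cat (R : realFieldType) (S : {fset R}) (a b c : R) :
  a <= b -> b <= c ->
  (#|` [fset r in S | (a < r < b)%R]| + #|` [fset r in S | (c < r)%R]|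
     <= #|` [fset r in S | (a < r)%R]|)%N.
Proof.
move=> ab bc; rewrite -cardfsUI (_ : _ `&` _ = fset0) ?cardfs0 ?addn0.
  apply/fsubset_leq_card/fsubsetP => r; rewrite !inE.
  case/orP=> [/and3P[-> -> _] //|/andP[-> cr]].
  by rewrite (le_lt_trans ab) // (le_lt_trans bc).
apply/fsetP => r; rewrite !inE; apply/negP.
by case/andP => /and3P[_ _ rb] /andP[_ cr]; lra.
Qed.

(** The elements of [L], in increasing order, split into consecutive windows of
    size [w]; the elements of [S] strictly inside different windows differ. *)
Lemma card_windows (R : realFieldType) (S L : {fset R}) (w b c : nat) :
  (0 < w)%N ->
  (forall u, size u = w -> sorted <%R u -> {subset u <= L} ->
     (b <= c * #|` [fset r in S | (head 0 u < r < last 0 u)%R]|)%N) ->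
  ((#|` L| %/ w) * b <= c * #|` S|)%N.
Proof.
move=> w0 hwin.
have key n s : (size s <= n)%N -> sorted <%R s -> {subset s <= L} ->
    ((size s %/ w) * b <=
     c * #|` [fset r in S | (s != [::]) && (head 0 s < r)%R]|)%N.
  elim: n s => [|n IHn] s.
    by rewrite leqn0 size_eq0 => /eqP -> _ _; rewrite div0n.
  move=> le_s srt sL; have [lt_w|le_w] := ltnP (size s) w.
    by rewrite divn_small.
  set u := take w s; set v := drop w s.
  have su : size u = w by rewrite size_takel.
  have uL : {subset u <= L} by move=> r /mem_take; exact: sL.
  have := hwin u su (take_sorted _ srt) uL.
  have : (size v <= n)%N by rewrite size_drop; lia.
  move=> /IHn /(_ (drop_sorted _ srt)).
  have vL : {subset v <= L} by move=> r /mem_drop; exact: sL.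
  move=> /(_ vL) IH hu.
  rewrite (_ : size s %/ w = (size v %/ w).+1)%N; last first.
    by rewrite size_drop -[in LHS](subnK le_w) divnDr ?dvdnn // divnn w0 addn1.
  rewrite mulSn; apply: leq_trans (leq_add hu IH) _; rewrite -mulnDr leq_mul2l.
  apply/orP; right.
  have s0 : s != [::] by rewrite -size_eq0 -lt0n (leq_trans w0).
  rewrite s0 /=.
  have hu0 : head 0 u = head 0 s by rewrite /u -!nth0 nth_take.
  have srt' : sorted <=%R s by apply: (sub_sorted _ srt) => ? ? /ltW.
  have u0 : u != [::] by rewrite -size_eq0 su -lt0n.
  have hl : head 0 u <= last 0 u.
    have := take_sorted w srt'; rewrite -/u; case: (u) u0 => // y u' _ /=.
    move=> /(order_path_min le_trans) /allP h; have := mem_last y u'.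
    by rewrite inE => /orP[/eqP -> //|/h].
  rewrite -hu0.
  have [v0|v0] := eqVneq v [::].
    rewrite [X in (_ + X)%N](_ : _ = 0%N) ?addn0.
      by apply/fsubset_leq_card/fsubsetP => r; rewrite !inE => /and3P[-> -> _].
    rewrite (_ : [fset r in _ | _] = fset0) ?cardfs0 //.
    by apply/fsetP => r; rewrite !inE andbF.
  rewrite /=; apply: card_interval_cat => //.
  have := srt'; rewrite -(cat_take_drop w s) -/u -/v.
  case: (u) u0 => // y u' _; case: (v) v0 => // y' v' _.
  by rewrite /= cat_path => /andP[_ /andP[]].
have srt : sorted <%R (sort <=%R L) by rewrite sort_lt_sorted fset_uniq.
have := key _ _ (leqnn _) srt; rewrite size_sort => /(_ _)/leq_trans; apply.
  by move=> r; rewrite mem_sort.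
rewrite leq_mul2l; apply/orP; right.
by apply/fsubset_leq_card/fsubsetP => r; rewrite !inE => /andP[].
Qed.

Section Slopes.
Variables (R : realFieldType) (B : {fset R}).
Hypothesis B_pos : {in B, forall x, 0 < x}.

Definition ratios := [fset y / x | y in B, x in B].
Definition sums := [fset x + y | x in B, y in B].
Definition sum_ratios := [fset u / v | u in sums, v in sums].
(** The abscissas of the points of the grid [B * B] on the line of slope [l]
    through the origin. *)
Definition on_line (l : R) := [fset x in B | l * x \in B].

Lemma mem_sum_ratios a b c d : a \in B -> b \in B -> c \in B -> d \in B ->
  (a + b) / (c + d) \in sum_ratios.
Proof.
move=> aB bB cB dB; apply/imfset2P; exists (a + b).
  by apply/imfset2P; exists a => //; exists b.
by exists (c + d) => //; apply/imfset2P; exists c => //; exists d.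
Qed.

Lemma on_lineP l x : reflect (x \in B /\ l * x \in B) (x \in on_line l).
Proof. by rewrite !inE; exact: andP. Qed.

Lemma mediant_sum_ratios l l' x z : x \in on_line l -> z \in on_line l' ->
  mediant l l' x z \in sum_ratios.
Proof. by move=> /on_lineP[? ?] /on_lineP[? ?]; exact: mem_sum_ratios. Qed.

Lemma ratio_on_line l : l \in ratios -> exists x, x \in on_line l.
Proof.
move=> /imfset2P[y /= yB [x xB ->]]; exists x; apply/on_lineP.
by rewrite divfK // lt0r_neq0 // B_pos.
Qed.

Lemma on_line_pos l x : x \in on_line l -> 0 < x.
Proof. by move=> /on_lineP[/B_pos]. Qed.

Lemma leq_on_line l : (#|` on_line l| <= #|` B|)%N.
Proof. by apply/fsubset_leq_card/fsubsetP => x /on_lineP[]. Qed.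

Lemma sum_on_line : (#|` B| ^ 2 <= \sum_(l <- ratios) #|` on_line l|)%N.
Proof.
have ratioP (p : B * B) : val p.1 / val p.2 \in ratios.
  by apply/imfset2P; exists (val p.1); [|exists (val p.2)]; rewrite /= ?fsvalP.
rewrite cardfE -mulnn -card_prod -sum1_card.
rewrite (partition_big (fun p => [` ratioP p]) predT) //= big_seq_fsetE /=.
apply: leq_sum => l _; rewrite sum1dep_card.
have ratio_eq (p : B * B) : p \in [set p | [` ratioP p] == l] ->
    val p.1 = val l * val p.2.
  rewrite inE -val_eqE /= => /eqP <-.
  by rewrite divfK // lt0r_neq0 // B_pos ?fsvalP.
apply: (@leq_card_finset_fset_inj _ _ (fun p => val p.2)).
  move=> [y x] [y' x'] /ratio_eq /= yE /ratio_eq /= y'E /val_inj xx'.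
  by congr (_, _) => //; apply: val_inj => /=; rewrite yE y'E xx'.
by move=> p /ratio_eq E; apply/on_lineP; rewrite -E !fsvalP.
Qed.

(** Adding one fixed vector of the line of slope [l'] to the vectors of the line
    of slope [l] produces sums of distinct slopes, strictly between the two. *)
Lemma on_line_gap l l' : l' \in ratios -> l < l' ->
  (#|` on_line l| <= #|` [fset r in sum_ratios | (l < r < l')%R]|)%N.
Proof.
move=> /ratio_on_line[z zl'] ll'; have z0 := on_line_pos zl'.
apply: (@leq_card_fset_inj _ _ (fun x => mediant l l' x z)).
  move=> x y /on_line_pos x0 /on_line_pos y0; exact: mediant_inj.
move=> x xl; have x0 := on_line_pos xl.
by rewrite !inE mediant_sum_ratios // mediant_gt // mediant_lt.
Qed.

(** The slopes produced by consecutive lines lie in disjoint intervals, so all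
    lines but the last, which has at most [#|` B|] points, contribute their
    number of points. *)
Lemma card_sum_ratios : (#|` B| ^ 2 <= #|` sum_ratios| + #|` B|)%N.
Proof.
apply: leq_trans sum_on_line _.
have key s : sorted <%R s -> {subset s <= ratios} ->
    (\sum_(l <- s) #|` on_line l| <=
     #|` [fset r in sum_ratios | (head 0 s < r)%R]| + #|` B|)%N.
  elim: s => [|l s IHs]; first by rewrite big_nil.
  case: s IHs => [|l' s] IHs.
    by rewrite big_seq1 => _ _; rewrite -[leqLHS]add0n leq_add ?leq_on_line.
  move=> /= /andP[ll' srt] sub; rewrite big_cons.
  apply: leq_trans (leq_add (leqnn _) (IHs srt _)) _.
    by move=> r rs; apply: sub; rewrite inE rs orbT.
  rewrite addnA leq_add2r.
  apply: leq_trans (card_interval_cat _ (ltW ll') (lexx l')).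
  by rewrite leq_add2r on_line_gap // sub // !inE eqxx orbT.
have srt : sorted <%R (sort <=%R ratios) by rewrite sort_lt_sorted fset_uniq.
have := key _ srt; rewrite (perm_big ratios) ?perm_sort //.
move=> /(_ _)/leq_trans; apply.
  by move=> r; rewrite mem_sort.
by rewrite leq_add2r; apply/fsubset_leq_card/fsubsetP => r; rewrite !inE => /andP[].
Qed.

Definition rich t := [fset l in ratios | (t <= #|` on_line l|)%N].

(** [cluster_mediants] applies to every [2 * M] consecutive rich slopes, the
    [M] smallest against the [M] largest, and yields slopes strictly inside the
    window; different windows do not interfere.  This gains a factor [M] over
    [card_sum_ratios] on the lines with [M ^ 6] points. *)
Lemma card_rich M : (0 < M)%N ->
  (#|` rich (M ^ 6)| * M ^ 7 <= 14 * #|` sum_ratios|)%N.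
Proof.
move=> M0.
have hwin u : size u = M.*2 -> sorted <%R u -> {subset u <= rich (M ^ 6)} ->
    (M ^ 8 <= 5 * #|` [fset r in sum_ratios | (head 0 u < r < last 0 u)%R]|)%N.
  move=> su srt uL.
  have u_rich i : (i < M.*2)%N -> (M ^ 6 <= #|` on_line (nth 0%R u i)|)%N.
    by rewrite -su => /(mem_nth 0) /uL; rewrite !inE => /andP[].
  have u_lt i j : (i < j < M.*2)%N -> nth 0 u i < nth 0 u j.
    move=> /andP[ij jM]; apply: (sorted_ltn_nth lt_trans) => //; rewrite !inE su //.
    exact: ltn_trans jM.
  have u_le i j : (i <= j < M.*2)%N -> nth 0 u i <= nth 0 u j.
    case/andP; rewrite leq_eqVlt => /orP[/eqP -> //|ij jM].
    by rewrite ltW // u_lt ?ij.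
  pose pts i k := nth 0 (enum_fset (on_line (nth 0 u i))) k.
  have pts_in i k : (i < M.*2)%N -> (k < M ^ 6)%N -> pts i k \in on_line (nth 0 u i).
    by move=> /u_rich le_i lt_k; apply: mem_nth; apply: leq_trans le_i.
  have pts_inj i k k' : (i < M.*2)%N -> (k < M ^ 6)%N -> (k' < M ^ 6)%N ->
      pts i k = pts i k' -> k = k'.
    move=> /u_rich le_i lt_k lt_k' /eqP.
    by rewrite nth_uniq ?fset_uniq ?(leq_trans _ le_i) // => /eqP.
  have lo (i : 'I_M) : (i < M.*2)%N by rewrite -addnn ltn_addr.
  have hi (i : 'I_M) : (M + i < M.*2)%N by rewrite -addnn ltn_add2l.
  have lohi (i j : 'I_M) : nth 0 u i < nth 0 u (M + j)%N.
    by apply: u_lt; rewrite hi ltn_addr.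
  apply: (@cluster_mediants _ M _ (fun i => nth 0 u i) (fun j => nth 0 u (M + j)%N)
            (fun i k => pts i k) (fun j k => pts (M + j)%N k)) => //.
  - move=> i j /eqP; rewrite nth_uniq ?su //; first by move/eqP/val_inj.
    by move: srt; rewrite lt_sorted_uniq_le => /andP[].
  - move=> i j /eqP; rewrite nth_uniq ?su //.
      by rewrite eqn_add2l => /eqP/val_inj.
    by move: srt; rewrite lt_sorted_uniq_le => /andP[].
  - by move=> i k k' /pts_inj e; apply/val_inj/e.
  - by move=> i k k' /pts_inj e; apply/val_inj/e.
  - by move=> i k; split; apply: on_line_pos; apply: pts_in.
  move=> i j s t; have xl := pts_in i s (lo _) (ltn_ord s).
  have zl := pts_in _ t (hi j) (ltn_ord t).
  have [x0 z0] := (on_line_pos xl, on_line_pos zl).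
  rewrite !inE mediant_sum_ratios //= -nth0 -nth_last su.
  rewrite (le_lt_trans _ (mediant_gt (lohi i j) x0 z0)) ?u_le ?lo //.
  rewrite (lt_le_trans (mediant_lt (lohi i j) x0 z0)) // u_le //.
  by have := ltn_ord j; rewrite -addnn; lia.
have w0 : (0 < M.*2)%N by rewrite double_gt0.
have := card_windows w0 hwin.
set k := #|` rich _|; set S := #|` sum_ratios| => hk.
have [->|k0] := posnP k; first by rewrite mul0n.
(* Fewer than [2 * M] slopes are left outside the windows; they account for
   at most [2 * M ^ 8], which the quadratic bound absorbs. *)
have MB : (M ^ 6 <= #|` B|)%N.
  move: k0; rewrite cardfs_gt0 => /fset0Pn[l]; rewrite !inE.
  move=> /andP[_ /leq_trans->//]; exact: leq_on_line.
have B2 : (#|` B| ^ 2 <= 2 * S)%N.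
  have := card_sum_ratios; rewrite -/S.
  have [b1|b1] := leqP #|` B| 1; last by nia.
  have : (0 < #|` B|)%N by apply: leq_trans MB; rewrite expn_gt0 M0.
  case: #|` B| b1 MB => [|[|]] // _ _ _ _.
  rewrite muln_gt0 /= cardfs_gt0; apply/fset0Pn.
  move: k0; rewrite cardfs_gt0 => /fset0Pn[l]; rewrite !inE.
  move=> /andP[/ratio_on_line[x xl] _].
  by exists (mediant l l x x); apply: mediant_sum_ratios.
have M8 : (M ^ 8 <= 2 * S)%N.
  apply: leq_trans B2; apply: (@leq_trans ((M ^ 6) ^ 2)); last by rewrite leq_exp2r.
  by rewrite -expnM leq_pexp2l.
have lt_k : (k <= (k %/ M.*2).+1 * M.*2)%N by rewrite ltnW // ltn_ceil.
have : (k * M ^ 7 <= (k %/ M.*2).+1 * M.*2 * M ^ 7)%N by rewrite leq_mul2r lt_k orbT.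
rewrite (_ : (k %/ M.*2).+1 * M.*2 * M ^ 7 = 2 * (k %/ M.*2 * M ^ 8) + 2 * M ^ 8)%N.
  by lia.
by rewrite -muln2 mulSn; ring.
Qed.

End Slopes.

(** * The expander bound *)

Lemma leq_dyadic_layers (a m N : nat) : (a <= (2 ^ N * m) ^ 6)%N ->
  (a <= m ^ 6 + \sum_(s < N) 64 * (2 ^ s * m) ^ 6 * ((2 ^ s * m) ^ 6 <= a))%N.
Proof.
elim: N => [|N IHN] aN; first by rewrite big_ord0 addn0 -[m]mul1n.
rewrite big_ord_recr /= addnA; have [/IHN h|lt_a] := leqP a ((2 ^ N * m) ^ 6).
  exact: leq_trans h (leq_addr _ _).
apply: leq_trans aN _; rewrite (ltnW lt_a) muln1 (expnS 2 N) -mulnA expnMn.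
by rewrite (_ : 64 = 2 ^ 6)%N // leq_addl.
Qed.

(** The terms are dominated by the geometric progression [y / 2 ^ s]. *)
Lemma sum_leq_geometric (x : nat -> nat) (y N : nat) :
  (forall s, (x s * 2 ^ s <= y)%N) -> (\sum_(s < N) x s <= 2 * y)%N.
Proof.
move=> xy; have key : (2 ^ N * (\sum_(s < N) x s) + 2 * y <= 2 * (2 ^ N * y))%N.
  elim: N => [|N IHN]; first by rewrite big_ord0; lia.
  rewrite big_ord_recr /= expnS; move: IHN (xy N).
  by move: (2 ^ N)%N (\sum_(s < N) x s)%N (x N) => p t x'; nia.
rewrite -(@leq_pmul2l (2 ^ N)) ?expn_gt0 // [leqRHS]mulnCA.
exact: leq_trans (leq_addr _ _) key.
Qed.

Section Expander.
Variables (R : realFieldType) (B : {fset R}).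
Hypothesis B_pos : {in B, forall x, 0 < x}.
Let n := #|` B|.
Let K := #|` ratios B|.
Let S := #|` sum_ratios B|.

Lemma card_rich_sum t :
  #|` rich B t| = (\sum_(l <- ratios B) (t <= #|` on_line B l|))%N.
Proof.
rewrite card_fset_sum1 /rich big_fset /= big_mkcond /=.
by apply: eq_bigr => l _; case: leqP.
Qed.

(** Count the [n ^ 2] points of the grid [B * B] by lines.  The lines with at
    most [m ^ 6] points carry at most [K * m ^ 6] of them.  The others are
    sorted dyadically: by [card_rich], those with about [(2 ^ s * m) ^ 6] points
    carry [O(S / (2 ^ s * m))] points.  These bounds form a geometric
    progression, so the summation costs no logarithm. *)
Lemma sq_card_layers m : (0 < m)%N -> (n ^ 2 * m <= K * m ^ 7 + 1792 * S)%N.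
Proof.
move=> m0.
have n2 : (n ^ 2 <= K * m ^ 6 +
    \sum_(s < n) 64 * (2 ^ s * m) ^ 6 * #|` rich B ((2 ^ s * m) ^ 6)|)%N.
  apply: leq_trans (sum_on_line B_pos) _.
  apply: (@leq_trans (\sum_(l <- ratios B) (m ^ 6 + \sum_(s < n)
     64 * (2 ^ s * m) ^ 6 * ((2 ^ s * m) ^ 6 <= #|` on_line B l|)))).
    apply: leq_sum => l _; apply: leq_dyadic_layers.
    apply: leq_trans (leq_on_line _ _) _; rewrite -/n.
    apply: leq_trans (ltnW (ltn_expl n (isT : 1 < 2)%N)) _.
    apply: (@leq_trans (2 ^ n * m)%N); first by rewrite leq_pmulr.
    by rewrite -[leqLHS]expn1 leq_pexp2l // muln_gt0 expn_gt0.
  rewrite big_split /= leq_add //.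
    by rewrite big_const_seq count_predT iter_addn_0 mulnC.
  rewrite exchange_big /=; apply: leq_sum => s _.
  by rewrite card_rich_sum big_distrr.
pose x s := (m * (2 ^ s * m) ^ 6 * #|` rich B ((2 ^ s * m) ^ 6)|)%N.
have xs s : (x s * 2 ^ s <= 14 * S)%N.
  have s0 : (0 < 2 ^ s * m)%N by rewrite muln_gt0 expn_gt0.
  by apply: leq_trans (card_rich B_pos s0); rewrite /x eq_leq //; ring.
(* The constant is 1792 = 64 * (2 * 14). *)
have := sum_leq_geometric n xs.
rewrite -(leq_pmul2r m0) in n2 => hx; apply: leq_trans n2 _.
rewrite mulnDl big_distrl /= -mulnA -expnSr leq_add2l.
rewrite (eq_bigr (fun s : 'I_n => 64 * x s)%N) => [|s _]; last by rewrite /x; ring.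
rewrite -big_distrr /=; apply: leq_trans (leq_mul (leqnn 64) hx) _.
by rewrite eq_leq //; ring.
Qed.

(** If [K * m ^ 6] is less than half of [n ^ 2], [sq_card_layers] gives the bound
    already for [S].  Otherwise the number [K] of ratios is at least
    [n ^ 2 / (2 * m ^ 6)], and [card_translates_lower] with [n ^ 2 <= 2 * S]
    bounds the fourth power of [#|` X|] from below by a multiple of
    [n ^ 10 / m ^ 12], which is at least [(n ^ 2 * m) ^ 4] since
    [m ^ 8 <= n]. *)
Lemma expander_bound (X : {fset R}) m :
  (forall a1 a2 a3 a4 a5 a6, a1 \in B -> a2 \in B -> a3 \in B -> a4 \in B ->
     a5 \in B -> a6 \in B -> (a1 + a2) / (a3 + a4) + a5 / a6 \in X) ->
  (0 < m)%N -> (m ^ 8 <= n)%N -> (n ^ 2 * m <= 3584 * #|` X|)%N.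
Proof.
move=> inX m0 mn; pose T := #|` X|.
have n0 : (0 < n)%N by apply: leq_trans mn; rewrite expn_gt0 m0.
have [b bB] : exists b, b \in B by apply/fset0Pn; rewrite -cardfs_gt0.
have SQ : {in sum_ratios B & ratios B, forall r q, r + q \in X}.
  move=> _ _ /imfset2P[_ /= /imfset2P[a1 /= ? [a2 ? ->]]
    [_ /imfset2P[a3 /= ? [a4 ? ->]] ->]] /imfset2P[a5 /= ? [a6 ? ->]].
  exact: inX.
have S_pos : {in sum_ratios B, forall r, 0 < r /\ r^-1 \in sum_ratios B}.
  move=> _ /imfset2P[_ /= /imfset2P[a1 /= ? [a2 ? ->]]
    [_ /imfset2P[a3 /= ? [a4 ? ->]] ->]]; split.
    by rewrite divr_gt0 // addr_gt0 // B_pos.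
  by rewrite invf_div mem_sum_ratios.
have ST : (S <= T)%N.
  apply: (@leq_card_fset_inj _ _ (fun r => r + b / b)) => [r r' _ _ /addIr //|r rS].
  by apply: SQ => //; apply/imfset2P; exists b => //; exists b.
have S0 : (0 < S)%N.
  rewrite cardfs_gt0; apply/fset0Pn; exists ((b + b) / (b + b)).
  exact: mem_sum_ratios.
have n2S : (n ^ 2 <= 2 * S)%N.
  by have := card_sum_ratios B_pos; rewrite -/n -/S; nia.
have KST := card_translates_lower S_pos SQ; rewrite -/K -/S -/T in KST.
have := sq_card_layers m0; rewrite -/T.
have [small|big] := leqP (2 * (K * m ^ 7)) (n ^ 2 * m); first by lia.
move=> _; apply: (@leq_trans (32 * T)%N); last by rewrite leq_mul2r orbT.
rewrite -(@leq_exp2r _ _ 4) //.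
have nK : (n ^ 2 <= 2 * (K * m ^ 6))%N.
  by rewrite -(leq_pmul2r m0) ltnW // (leq_trans big) // eq_leq //; ring.
have nK2 : ((n ^ 2) ^ 2 <= (2 * (K * m ^ 6)) ^ 2)%N by rewrite leq_exp2r.
have nS3 : ((n ^ 2) ^ 3 <= (2 * S) ^ 3)%N by rewrite leq_exp2r.
have mn2 : ((m ^ 8) ^ 2 <= n ^ 2)%N by rewrite leq_exp2r.
have := leq_mul nK2 nS3.
rewrite (_ : (2 * (K * m ^ 6)) ^ 2 * (2 * S) ^ 3 =
   32 * m ^ 12 * (K ^ 2 * S ^ 3))%N; last by ring.
move=> /leq_trans /(_ (leq_mul (leqnn _) KST)) h.
have := leq_mul (leqnn (n ^ 8)) mn2.
rewrite (_ : n ^ 8 * n ^ 2 = (n ^ 2) ^ 2 * (n ^ 2) ^ 3)%N; last by ring.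
move=> /leq_trans /(_ h).
rewrite (_ : n ^ 8 * (m ^ 8) ^ 2 = m ^ 12 * (n ^ 2 * m) ^ 4)%N; last by ring.
rewrite (_ : 32 * m ^ 12 * _ = m ^ 12 * (2 ^ 17 * T ^ 4))%N; last by ring.
rewrite leq_pmul2l ?expn_gt0 ?m0 // => /leq_trans; apply.
rewrite expnMn leq_mul2r; apply/orP; right.
by rewrite (_ : 32 = 2 ^ 5)%N // -expnM leq_pexp2l.
Qed.

End Expander.

(** Ratios of sums are unchanged when all elements change sign, so the positive
    elements of [A] may be replaced by the opposites of the negative ones; take
    the more numerous of the two.  Since [A] may contain [0], this keeps a third
    of the elements. *)
Lemma positive_part (R : realType) (A : {fset R}) : (2 <= #|` A|)%N ->
  exists B : {fset R}, [/\ {in B, forall x, 0 < x}, (#|` A| <= 3 * #|` B|)%N &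
    forall a1 a2 a3 a4 a5 a6, a1 \in B -> a2 \in B -> a3 \in B -> a4 \in B ->
      a5 \in B -> a6 \in B ->
      (a1 + a2) / (a3 + a4) + a5 / a6 \in fset_set (ratio_sumset A)].
Proof.
move=> A2.
pose P := [fset x in A | 0 < x]%fset.
pose N := [fset - x | x in [fset x in A | (x < 0)%R]]%fset.
have cN : #|` N| = #|` [fset x in A | (x < 0)%R]%fset|.
  by rewrite card_imfset //; exact: oppr_inj.
have P_mem x : x \in P -> x \in A /\ 0 < x by rewrite !inE => /andP.
have N_mem x : x \in N -> - x \in A /\ 0 < x.
  by case/imfsetP => y /=; rewrite !inE => /andP[yA y0] ->; rewrite opprK oppr_gt0.
have A_le : (#|` A| <= 1 + (#|` P| + #|` N|))%N.
  rewrite cN; apply: (@leq_trans #|` 0 |` (P `|` [fset x in A | (x < 0)%R])|%fset).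
    apply/fsubset_leq_card/fsubsetP => x xA; rewrite !inE xA /=.
    by case: ltgtP.
  rewrite cardfsU1 leq_add ?leq_b1 //.
  by rewrite -cardfsUI leq_addr.
have mem_X x : ratio_sumset A x -> x \in fset_set (ratio_sumset A).
  by move=> ?; rewrite in_fset_set ?inE //; exact: finite_ratio_sumset.
have arith (a p q : nat) : (2 <= a)%N -> (a <= 1 + (p + q))%N -> (q <= p)%N ->
    (a <= 3 * p)%N by lia.
have [PN|/ltnW NP] := leqP #|` N| #|` P|.
  exists P; split=> [x /P_mem[]//||a1 a2 a3 a4 a5 a6]; first exact: arith PN.
  move=> /P_mem[? _] /P_mem[? _] /P_mem[? ?] /P_mem[? ?] /P_mem[? _] /P_mem[? ?].
  apply: mem_X; exists a1, a2, a3, a4, a5, a6.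
  by split; rewrite // lt0r_neq0 ?addr_gt0.
exists N; split=> [x /N_mem[]//||a1 a2 a3 a4 a5 a6].
  by apply: arith NP => //; rewrite [X in (1 + X)%N]addnC.
move=> /N_mem[? _] /N_mem[? _] /N_mem[? ?] /N_mem[? ?] /N_mem[? _] /N_mem[? ?].
apply: mem_X; exists (- a1), (- a2), (- a3), (- a4), (- a5), (- a6).
split; rewrite ?oppr_eq0 -?opprD ?oppr_eq0 // ?lt0r_neq0 ?addr_gt0 //.
by rewrite !invrN !mulrNN.
Qed.

Theorem theorem1p3 (R : realType) :
  exists c : R, 0 < c /\
    forall A : {fset R}, (2 <= #|` A|)%N ->
      c * (#|` A|%:R `^ (2 + 2 / 17) / log2 (#|` A|%:R) `^ (16 / 17))
        <= #|` fset_set (ratio_sumset A)|%:R.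
Proof.
exists (36 * 3584)^-1; split; first by rewrite invr_gt0; lra.
move=> A A2; have [B [B_pos AB BX]] := positive_part A2.
set N := #|` A| in A2 AB *; set X := #|` _|; pose n := #|` B|.
have n0 : (0 < n)%N by rewrite /n; lia.
(* [m] is the integer part of the eighth root of [n]. *)
have [m /= mn m_max] : {m | (m ^ 8 <= n)%N & forall k, (k ^ 8 <= n -> k <= m)%N}.
  have ex : exists k, (k ^ 8 <= n)%N by exists 0%N.
  have le_n k : (k ^ 8 <= n)%N -> (k <= n)%N.
    by apply: leq_trans; case: k => // k; rewrite -[leqLHS]expn1 leq_pexp2l.
  by case: (ex_maxnP ex le_n) => m ? ?; exists m.
have m0 : (0 < m)%N by apply: m_max; rewrite exp1n.
have n_lt : (n < m.+1 ^ 8)%N.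
  by rewrite ltnNge; apply/negP => /m_max; rewrite ltnn.
have main := expander_bound B_pos BX m0 mn; rewrite -/n -/X in main.
(* [N] is at most [3 * n], and [n] is less than the eighth power of [2 * m]. *)
have N8 : N%:R <= (4 * m%:R) ^+ 8 :> R.
  rewrite -natrM -natrX ler_nat; apply: (leq_trans AB).
  rewrite (_ : 4 = 2 * 2)%N // -mulnA expnMn leq_mul //.
  by rewrite ltnW // (leq_trans n_lt) // leq_exp2r // mul2n -addnn -addn1 leq_add2l.
have N1 : 1 <= N%:R :> R by rewrite ler1n ltnW.
have logN : 1 <= log2 N%:R :> R.
  rewrite /log2 ler_pdivlMr ?mul1r ?ln_gt0 ?ltr1n // ler_ln ?posrE ?ltr0n ?ler_nat //.
  by lia.
have logN' : 1 <= log2 N%:R `^ (16 / 17) :> R.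
  by rewrite -[leLHS](powRr0 (log2 N%:R)) ler_powR //; lra.
have N17 : N%:R `^ (2 / 17) <= 4 * m%:R :> R.
  apply: (@le_trans _ _ (N%:R `^ (8%:R)^-1)); first by rewrite ler_powR //; lra.
  have m4 : 0 <= 4 * m%:R :> R by rewrite mulr_ge0.
  have -> : 4 * m%:R = ((4 * m%:R) `^ 8%:R) `^ (8%:R)^-1 :> R.
    by rewrite -powRrM mulfV ?pnatr_eq0 // powRr1.
  by rewrite powR_mulrn // ge0_ler_powR ?nnegrE ?invr_ge0 ?exprn_ge0.
have N2 : N%:R ^+ 2 <= 9 * n%:R ^+ 2 :> R.
  rewrite (_ : 9 * _ = (3 * n%:R) ^+ 2); last by ring.
  by rewrite lerXn2r ?nnegrE ?mulr_ge0 // -natrM ler_nat.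
have XR : n%:R ^+ 2 * m%:R <= 3584 * X%:R :> R by rewrite -natrX -!natrM ler_nat.
rewrite mulrC ler_pdivrMr; last by lra.
rewrite ler_pdivrMr ?(lt_le_trans ltr01) //.
rewrite powRD; last by apply/implyP => _; rewrite gt_eqF // (lt_le_trans ltr01).
rewrite powR_mulrn ?(le_trans ler01) //.
have X0 : 0 <= X%:R * (36 * 3584) :> R by apply: mulr_ge0; [exact: ler0n|lra].
have := ler_wpM2l X0 logN'; rewrite [X in X <= _]mulr1; apply: le_trans.
apply: (@le_trans _ _ (9 * n%:R ^+ 2 * (4 * m%:R))).
  by rewrite ler_pM ?powR_ge0 ?sqr_ge0.
by lra.
Qed.
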